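(* Let $\mathcal{C}$ be a full trio of semi-linear languages. Then every language in $\mathcal{C}\wedge\mathcal{L}(\mathrm{NCM})=\{L_1\cap L_2 : L_1\in\mathcal{C},\ L_2\in\mathcal{L}(\mathrm{NCM})\}$ has a semi-linear Parikh image.
   Context: A full trio is a family of languages closed under morphism (possibly erasing), inverse morphism, and intersection with regular languages. For an alphabet $A=\{a_1,\dots,a_t\}$ the Parikh morphism is $\psi:A^*\to\mathbb{N}^t$, $\psi(w)=(|w|_{a_1},\dots,|w|_{a_t})$, and the Parikh image of $L\subseteq A^*$ is $\psi(L)$. A subset of $\mathbb{N}^t$ is linear if it has the form $b_0+\{x_1b_1+\cdots+x_nb_n : x_i\in\mathbb{N}\}$ for some $b_0,\dots,b_n\in\mathbb{N}^t$, and semi-linear if it is a finite union of linear sets. A language is semi-linear if its Parikh image is semi-linear. $\mathcal{L}(\mathrm{NCM})$ is the family of languages accepted by one-way nondeterministic reversal-bounded multicounter machines: nondeterministic finite automata with a one-way input, augmented by finitely many counters holding non-negative integers, each of which can be incremented by 1, decremented by 1, and tested for zero, and such that there is a fixed bound on the number of times each counter switches between increasing and decreasing in an accepting computation. *)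

(* Defs.v *)
From mathcomp Require Import all_boot all_order all_algebra.
From mathcomp Require Import boolp classical_sets.

Set Implicit Arguments.
Unset Strict Implicit.
Unset Printing Implicit Defensive.

Import GRing.Theory.

Local Open Scope classical_set_scope.
Local Open Scope ring_scope.

Definition language (A : finType) := set (seq A).

Definition language_family := forall A : finType, set (language A).

Definition word_morphism (A B : finType) (h : seq A -> seq B) : Prop :=
  h [::] = [::] /\ {morph h : u v / u ++ v}.

Definition regular (A : finType) (L : language A) : Prop :=
  exists (Q : finType) (q0 : Q) (F : {set Q}) (delta : Q -> A -> Q),
    L = [set w | foldl delta q0 w \in F].

Record full_trio (C : language_family) : Prop := FullTrio {
  full_trio_morphism : forall (A B : finType) (h : seq A -> seq B)
    (L : language A), word_morphism h -> C A L -> C B (h @` L);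
  full_trio_inverse_morphism : forall (A B : finType) (h : seq A -> seq B)
    (L : language B), word_morphism h -> C B L -> C A (h @^-1` L);
  full_trio_regular : forall (A : finType) (L K : language A),
    C A L -> regular K -> C A (L `&` K)
}.

(* The alphabet itself indexes the coordinates: N^t is {ffun A -> nat}, with
   pointwise addition. *)
Definition parikh (A : finType) (w : seq A) : {ffun A -> nat} :=
  [ffun a => count_mem a w].

Definition linear_set (A : finType) (X : set {ffun A -> nat}) : Prop :=
  exists (n : nat) (b0 : {ffun A -> nat}) (b : 'I_n -> {ffun A -> nat}),
    X = [set b0 + \sum_(i < n) b i *+ x i | x in [set: 'I_n -> nat]].

(* The union of no linear sets is allowed, so set0 is semi-linear. *)
Definition semilinear_set (A : finType) (X : set {ffun A -> nat}) : Prop :=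
  exists (m : nat) (Y : 'I_m -> set {ffun A -> nat}),
    (forall j, linear_set (Y j)) /\ X = \bigcup_j Y j.

Definition semilinear_language (A : finType) (L : language A) : Prop :=
  semilinear_set (@parikh A @` L).

Inductive counter_op := Incr | Decr | Stay.

(* Decr is not enabled on an empty counter. *)
Definition counter_step (o : counter_op) (c c' : nat) : Prop :=
  match o with
  | Incr => c' = c.+1
  | Decr => c = c'.+1
  | Stay => c' = c
  end.

(* A transition reads a letter (Some a) or nothing (None), is guarded by which
   counters are zero (true means zero), and acts on all counters at once. *)
Record counter_machine (A : finType) := CounterMachine {
  cm_counters : nat;
  cm_state : finType;
  cm_start : cm_state;
  cm_final : {set cm_state};
  cm_trans : cm_state -> option A -> {ffun 'I_cm_counters -> bool} ->
             cm_state -> {ffun 'I_cm_counters -> counter_op} -> bool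
}.

Section CounterMachine.
Variables (A : finType) (M : counter_machine A).

Definition cm_ops := {ffun 'I_(cm_counters M) -> counter_op}.
Definition cm_values := {ffun 'I_(cm_counters M) -> nat}.

(* cm_run q w c s q' c': some computation leads from state q and counters c to
   state q' and counters c', consumes exactly w, and performs the successive
   counter operations s. *)
Inductive cm_run : cm_state M -> seq A -> cm_values -> seq cm_ops ->
                   cm_state M -> cm_values -> Prop :=
| cm_run_nil (q : cm_state M) (c : cm_values) : cm_run q [::] c [::] q c
| cm_run_cons (q q1 q2 : cm_state M) (x : option A) (w : seq A)
    (c c1 c2 : cm_values) (o : cm_ops) (s : seq cm_ops) :
    cm_trans q x [ffun i => c i == 0%N] q1 o ->
    (forall i : 'I_(cm_counters M), counter_step (o i) (c i) (c1 i)) ->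
    cm_run q1 w c1 s q2 c2 ->
    cm_run q (oapp (fun a => a :: w) w x) c (o :: s) q2 c2.

Definition cm_accepting (w : seq A) (s : seq cm_ops) : Prop :=
  exists (q : cm_state M) (c : cm_values),
    q \in cm_final M /\ cm_run (cm_start M) w [ffun=> 0%N] s q c.

Definition cm_language : language A := [set w | exists s, cm_accepting w s].

End CounterMachine.

Definition op_direction (o : counter_op) : option bool :=
  match o with Incr => Some true | Decr => Some false | Stay => None end.

(* Stay steps are dropped before counting changes of direction. *)
Definition reversals (s : seq counter_op) : nat :=
  let d := pmap op_direction s in count id (pairmap addb (head true d) d).

Definition reversal_bounded (A : finType) (M : counter_machine A) : Prop :=
  exists r : nat, forall (w : seq A) (s : seq (cm_ops M)),
    cm_accepting w s ->
    forall i : 'I_(cm_counters M), (reversals [seq o i | o : cm_ops M <- s] <= r)%N.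

Definition NCM : language_family := fun A =>
  [set L | exists M : counter_machine A, reversal_bounded M /\ L = cm_language M].
Arguments NCM : clear implicits.

Definition wedge (C D : language_family) : language_family := fun A =>
  [set L1 `&` L2 | L1 in C A & L2 in D A].
Arguments wedge : clear implicits.

(* Main.v *)
(* Split the life of each counter into phases on which it is monotone and has a
   fixed zero status; reversal-boundedness bounds the number of phases. The words
   over the transitions of the machine, annotated with phases, that chain
   correctly form a regular language, so those that moreover spell a word of the
   given language of C form a language of C, whose Parikh image is semi-linear.
   The zero tests and the non-negativity of the counters become finitely many
   linear inequalities between numbers of occurrences of annotated transitions,
   depending only on which phases are visited. Finally, cutting a semi-linear set
   by linear inequalities and projecting leaves it semi-linear, by Dickson's
   lemma. *)
Require Import Defs.
From HB Require Import structures.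
From mathcomp Require Import all_boot all_order all_algebra.
From mathcomp Require Import boolp classical_sets.
From mathcomp Require Import zify.

Set Implicit Arguments.
Unset Strict Implicit.
Unset Printing Implicit Defensive.

Import Order.TTheory GRing.Theory Num.Theory.

Local Open Scope classical_set_scope.
Local Open Scope ring_scope.

(** * Dickson's lemma and finite unions of semi-linear sets *)

(** Induction on the list of coordinates. If [N] bounds coordinate [k] on a basis for the remaining
    coordinates, that basis dominates every point with [f k x >= N]; below [N] there are finitely
    many slices on which [f k] is constant, each with its own basis. *)
Lemma dickson (T K : eqType) (f : K -> T -> nat) (s : seq K) (S : set T) :
  exists B : seq T, {in B, forall y, S y} /\
    forall x, S x -> exists2 y, y \in B & {in s, forall k, (f k y <= f k x)%N}.
Proof.
elim: s S => [|k s IH] S.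
  have [[x0 Sx0]|S0] := pselect (exists x, S x).
    exists [:: x0]; split=> [y|x _]; first by rewrite inE => /eqP->.
    by exists x0; rewrite ?inE.
  by exists [::]; split=> // x Sx; case: S0; exists x.
have [B0 [B0S B0P]] := IH S.
have [B' B'P] := choice (fun j => IH [set x | S x /\ f k x = j]).
pose N := (\max_(y <- B0) f k y)%N.
exists (B0 ++ flatten [seq B' j | j <- iota 0 N]); split=> [y|x Sx].
  rewrite mem_cat => /orP[/B0S//|/flatten_mapP[j _ yB]].
  by have [/(_ y yB)[]] := B'P j.
have [lt_N|ge_N] := ltnP (f k x) N.
  have [_ /(_ x (conj Sx erefl))[y yB le_yx]] := B'P (f k x).
  have [yk] : (S y /\ f k y = f k x) by have [/(_ y yB)] := B'P (f k x).
  move=> yk'; exists y.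
    rewrite mem_cat; apply/orP; right; apply/flatten_mapP; exists (f k x) => //.
    by rewrite mem_iota add0n.
  by move=> i; rewrite inE => /orP[/eqP->|/le_yx//]; rewrite yk'.
have [y yB le_yx] := B0P x Sx; exists y; first by rewrite mem_cat yB.
move=> i; rewrite inE => /orP[/eqP->|/le_yx//].
by apply: leq_trans ge_N; rewrite /N (big_rem y yB) leq_maxl.
Qed.

Lemma semilinear_bigcup_linear (A I : finType) (Y : I -> set {ffun A -> nat}) :
  (forall i, linear_set (Y i)) -> semilinear_set (\bigcup_i Y i).
Proof.
move=> linY; exists #|I|, (fun j => Y (enum_val j)); split=> [j|]; first exact: linY.
rewrite eqEsubset; split=> v [i _ Yi]; last by exists (enum_val i).
by exists (enum_rank i); rewrite ?enum_rankK.
Qed.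

Lemma semilinear_bigcup (A I : finType) (Y : I -> set {ffun A -> nat}) :
  (forall i, semilinear_set (Y i)) -> semilinear_set (\bigcup_i Y i).
Proof.
move=> semY; pose m i := projT1 (cid (semY i)).
pose Z i : 'I_(m i) -> _ := projT1 (cid (projT2 (cid (semY i)))).
have ZP i : (forall j, linear_set (@Z i j)) /\ Y i = \bigcup_j @Z i j.
  exact: projT2 (cid (projT2 (cid (semY i)))).
have -> : \bigcup_i Y i = \bigcup_(p in [set: {i : I & 'I_(m i)}]) @Z (tag p) (tagged p).
  rewrite eqEsubset; split=> v [i _].
    by rewrite (ZP i).2 => -[j _ Zv]; exists (Tagged (fun i => 'I_(m i)) j).
  by move=> Zv; exists (tag i) => //; rewrite (ZP _).2; exists (tagged i).
by apply: semilinear_bigcup_linear => p; apply: (ZP _).1.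
Qed.

(** * Cutting semi-linear sets by linear inequalities *)

Section LinearCombination.
Variables (I : finType) (V : nmodType) (f : I -> V).

Definition lincomb (v : {ffun I -> nat}) : V := \sum_i f i *+ v i.

Lemma lincomb_ffun (x : I -> nat) : lincomb [ffun i => x i] = \sum_i f i *+ x i.
Proof. by apply: eq_bigr => i _; rewrite ffunE. Qed.

Lemma lincombD v w : lincomb (v + w) = lincomb v + lincomb w.
Proof. by rewrite -big_split; apply: eq_bigr => i _; rewrite ffunE mulrnDr. Qed.

Lemma lincomb0 : lincomb 0 = 0.
Proof. by apply: big1 => i _; rewrite ffunE. Qed.

Lemma lincomb_sum n (b : 'I_n -> {ffun I -> nat}) (x : 'I_n -> nat) :
  lincomb (\sum_(i < n) b i *+ x i) = \sum_(i < n) lincomb (b i) *+ x i.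
Proof.
rewrite (big_morph lincomb lincombD lincomb0); apply: eq_bigr => i _.
elim: (x i) => [|k IH]; first by rewrite !mulr0n lincomb0.
by rewrite !mulrS lincombD IH.
Qed.

Lemma lincomb_parikh (w : seq I) : lincomb (parikh w) = \sum_(a <- w) f a.
Proof.
elim: w => [|a w IH].
  by rewrite big_nil; apply: big1 => i _; rewrite ffunE.
rewrite big_cons -IH /lincomb (bigD1 a) //= [in RHS](bigD1 a) //= addrA -mulrS.
rewrite !ffunE /= eqxx; congr (_ + _); apply: eq_bigr => i ne_ia.
by rewrite !ffunE /= eq_sym (negbTE ne_ia).
Qed.

End LinearCombination.

Section Affine.
Variables (A J : finType) (n : nat).
Variables (c0 : J -> int) (c : J -> 'I_n -> int).
Implicit Types x y z : {ffun 'I_n -> nat}.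

(* Comparing the values of the inequalities as well as the coordinates makes the
   difference z satisfy the homogeneous inequalities. *)
Lemma dickson_affine (d : J -> int) (S : set {ffun 'I_n -> nat}) :
    (forall x, S x -> forall j, 0 <= d j + lincomb (c j) x) ->
  exists B : seq {ffun 'I_n -> nat}, {in B, forall y, S y} /\
    forall x, S x -> exists y z, [/\ y \in B, x = y + z &
      forall j, 0 <= lincomb (c j) z].
Proof.
move=> dS.
pose f (k : 'I_n + J) x : nat :=
  match k with inl i => x i | inr j => absz (d j + lincomb (c j) x) end.
have [B [BS BP]] := dickson f (enum {: 'I_n + J}) S.
exists B; split=> // x Sx; have [y yB le_yx] := BP x Sx.
pose z := [ffun i => x i - y i]%N.
have Exy : x = y + z.
  apply/ffunP => i; rewrite !ffunE; symmetry; apply: subnKC.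
  by apply: (le_yx (inl i)); rewrite mem_enum.
exists y, z; split=> // j.
have := le_yx (inr j) (mem_enum _ _).
have := dS x Sx j; have := dS y (BS y yB) j.
by rewrite /f Exy lincombD; lia.
Qed.

(** The Dickson basis of the nonzero solutions generates all of them: subtracting a basis element
    below [x] leaves a homogeneous solution with a smaller coordinate sum. *)
Lemma affine_basis : exists H : seq {ffun 'I_n -> nat},
  (forall y, y \in H -> forall j, 0 <= lincomb (c j) y) /\
  forall x, (forall j, 0 <= lincomb (c j) x) ->
    exists z : 'I_(size H) -> nat, x = \sum_(l < size H) H`_l *+ z l.
Proof.
have [|H [HS HP]] := @dickson_affine (fun=> 0)
  [set x | (forall j, 0 <= lincomb (c j) x) /\ x <> 0].
  by move=> x [xP _] j; rewrite add0r.
exists H; split=> [y /HS[]//|x].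
have [k] := ubnP (\sum_i x i)%N; elim: k x => // k IH x lt_k xM.
have [->|/eqP x0] := eqVneq x 0.
  by exists (fun=> 0%N); rewrite big1.
have [y [z [yH Exyz zM]]] := HP x (conj xM x0).
have [_ y0] := HS y yH.
have Hy : (index y H < size H)%N by rewrite index_mem.
have [|t Et] := IH z _ zM.
  have y_gt0 : (0 < \sum_i y i)%N.
    rewrite lt0n; apply/eqP => /eqP; rewrite sum_nat_eq0 => /forallP y00.
    by apply: y0; apply/ffunP => i; rewrite ffunE; apply/eqP/(implyP (y00 i)).
  have : (\sum_i x i = \sum_i y i + \sum_i z i)%N.
    by rewrite -big_split Exyz; apply: eq_bigr => i _; rewrite ffunE.
  by lia.
exists (fun l => (l == Ordinal Hy) + t l)%N.
rewrite (eq_bigr (fun l : 'I_(size H) => H`_l *+ (l == Ordinal Hy) + H`_l *+ t l)).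
  rewrite big_split -Et (bigD1 (Ordinal Hy)) //= eqxx nth_index // big1 ?addr0 //.
  by move=> l /negbTE ->.
by move=> l _; rewrite mulrnDr.
Qed.

(** Every solution is one of finitely many base points plus a homogeneous solution, and the latter
    are generated by a finite basis; applying [lincomb b] gives one linear set per base point. *)
Lemma semilinear_affine (b0 : {ffun A -> nat}) (b : 'I_n -> {ffun A -> nat}) :
  semilinear_set [set b0 + lincomb b x | x in
    [set x | forall j, 0 <= c0 j + lincomb (c j) x]].
Proof.
have [B [BS BP]] := @dickson_affine c0 [set x | forall j, 0 <= c0 j + lincomb (c j) x]
  (fun _ => id).
have [H [HM HP]] := affine_basis.
pose Y (l : 'I_(size B)) := [set b0 + lincomb b B`_l +
  \sum_(h < size H) lincomb b H`_h *+ z h | z in [set: 'I_(size H) -> nat]].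
have -> : [set b0 + lincomb b x | x in [set x | forall j, 0 <= c0 j + lincomb (c j) x]] =
    \bigcup_l Y l.
  rewrite eqEsubset; split=> ? [].
    move=> x xS <-; have [y [z [yB -> zM]]] := BP x xS; have [t ->] := HP z zM.
    have Hy : (index y B < size B)%N by rewrite index_mem.
    exists (Ordinal Hy) => //; exists t => //.
    by rewrite /= nth_index // lincombD lincomb_sum addrA.
  move=> l _ [z _ <-]; exists (B`_l + \sum_(h < size H) H`_h *+ z h); last first.
    by rewrite lincombD lincomb_sum addrA.
  move=> j; rewrite lincombD addrA lincomb_sum; apply: addr_ge0.
    by apply: BS; apply: mem_nth.
  by apply: sumr_ge0 => h _; apply: mulrn_wge0; apply: HM; apply: mem_nth.
apply: semilinear_bigcup_linear => l.
by exists (size H), (b0 + lincomb b B`_l), (fun h => lincomb b H`_h).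
Qed.

End Affine.

(** On a linear set, the inequalities on [v] become affine inequalities on the multiplicities of the
    periods. *)
Lemma semilinear_constrained_image (I A J : finType) (g : I -> {ffun A -> nat})
    (u : J -> I -> int) (k : J -> int) (X : set {ffun I -> nat}) :
  semilinear_set X ->
  semilinear_set (lincomb g @` (X `&` [set v | forall j, k j <= lincomb (u j) v])).
Proof.
move=> [m [Y [linY ->]]].
have -> : lincomb g @` ((\bigcup_l Y l) `&` [set v | forall j, k j <= lincomb (u j) v]) =
    \bigcup_l (lincomb g @` (Y l `&` [set v | forall j, k j <= lincomb (u j) v])).
  rewrite eqEsubset; split=> ? [].
    by move=> v [[l _ Yv] vP] <-; exists l => //; exists v.
  by move=> l _ [v [Yv vP] <-]; exists v => //; split=> //; exists l.
apply: semilinear_bigcup => l; have [n [b0 [b ->]]] := linY l.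
have := @semilinear_affine A J n (fun j => lincomb (u j) b0 - k j)
  (fun j i => lincomb (u j) (b i)) (lincomb g b0) (fun i => lincomb g (b i)).
congr semilinear_set; rewrite eqEsubset; split=> ? [].
  move=> x xP <-; exists (b0 + \sum_(i < n) b i *+ x i).
    split=> [|j]; first by exists x.
    by rewrite lincombD lincomb_sum -subr_ge0 addrAC; apply: xP.
  by rewrite lincombD lincomb_sum.
move=> _ [[x _ <-] xP] <-; exists [ffun i => x i].
  by move=> j; rewrite /= lincomb_ffun addrAC subr_ge0 -lincomb_sum -lincombD.
by rewrite lincombD lincomb_sum lincomb_ffun.
Qed.

(** * Phases of a single counter *)

(** Makes [counter_op] a finite type, so that annotated transitions form an alphabet. *)
Definition op_of_direction (d : option bool) : counter_op :=
  match d with Some true => Incr | Some false => Decr | None => Stay end.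

Lemma op_directionK : cancel op_direction op_of_direction.
Proof. by case. Qed.

HB.instance Definition _ := Finite.copy counter_op (can_type op_directionK).

Definition op_effect (o : counter_op) : int :=
  match o with Incr => 1 | Decr => -1 | Stay => 0 end.

(* Phases 4j, 4j+1, 4j+2, 4j+3 of a counter: zero and then positive while it
   rises, positive and then zero while it falls. *)
Definition zero_phase (p : nat) : bool := odd p == odd p./2.

Definition rising_phase (p : nat) : bool := ~~ odd p./2.

(** Restricts only the steps that stay in phase [p], not those that leave it. *)
Definition op_allowed (p : nat) (o : counter_op) : bool :=
  match o with
  | Stay => true
  | Incr => ~~ zero_phase p && rising_phase p
  | Decr => ~~ zero_phase p && ~~ rising_phase p
  end.

(** Values are integers here, since a sum of effects is not known in advance to be non-negative. *)
Definition in_phase (p : nat) (z : int) : bool :=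
  if zero_phase p then z == 0 else 1 <= z.

(** A trace entry holds the phase before a step, the operation, and the phase after it. *)
Fixpoint well_phased (p0 : nat) (t : seq (nat * counter_op * nat)) : bool :=
  if t is (p, o, p1) :: t' then
    [&& p == p0, (p0 <= p1)%N, (p0 == p1) ==> op_allowed p0 o & well_phased p1 t']
  else true.

Fixpoint values_in_phase (p0 : nat) (z : int) (t : seq (nat * counter_op * nat)) : bool :=
  in_phase p0 z &&
  if t is (_, o, p1) :: t' then values_in_phase p1 (z + op_effect o) t' else true.

(** As phases never decrease along a trace, this is the net effect up to the entry into a visited
    phase [p]. Written as a filtered sum, it depends only on how often each entry occurs. *)
Definition entry_value (p : nat) (t : seq (nat * counter_op * nat)) : int :=
  \sum_(e <- t | (e.1.1 < p)%N) op_effect e.1.2.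

Definition exit_value (p : nat) (t : seq (nat * counter_op * nat)) : int :=
  \sum_(e <- t | (e.2 <= p)%N) op_effect e.1.2.

(* Within a phase a counter is monotone, so its minimum there is the first value
   of a rising phase and the last value of a falling one. *)
Definition phase_constraint (z : int) (t : seq (nat * counter_op * nat)) (p : nat) : bool :=
  if zero_phase p then z + entry_value p t == 0
  else if rising_phase p then 1 <= z + entry_value p t
  else 1 <= z + exit_value p t.

Lemma well_phased_ge p0 t : well_phased p0 t ->
  {in t, forall e, (p0 <= e.1.1)%N && (p0 <= e.2)%N}.
Proof.
elim: t p0 => // -[[p o] p1] t IH p0 /and4P[/eqP-> le01 _ /IH{}IH] e.
rewrite inE => /orP[/eqP->/=|/IH/andP[le1 le2]]; first by rewrite leqnn.
by rewrite !(leq_trans le01).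
Qed.

Lemma entry_value0 p0 p t : well_phased p0 t -> (p <= p0)%N -> entry_value p t = 0.
Proof.
move=> /well_phased_ge tP le_p; rewrite /entry_value big_seq_cond big1 // => e.
by move=> /andP[/tP/andP[le0 _]]; rewrite ltnNge (leq_trans le_p le0).
Qed.

Lemma exit_value0 p0 p t : well_phased p0 t -> (p < p0)%N -> exit_value p t = 0.
Proof.
move=> /well_phased_ge tP lt_p; rewrite /exit_value big_seq_cond big1 // => e.
by move=> /andP[/tP/andP[_ le0]]; rewrite leqNgt (leq_trans lt_p le0).
Qed.

(** Induction on the trace: for phases after [p0] the first step merely shifts [z], while within
    [p0] the allowed operations make the counter monotone, so the extreme value controls the
    others. *)
Lemma values_in_phaseP p0 z t : well_phased p0 t ->
  values_in_phase p0 z t <->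
  {in p0 :: [seq e.2 | e <- t], forall p, phase_constraint z t p}.
Proof.
elim: t p0 z => [|[[p o] p1] t IH] p0 z.
  rewrite /= andbT /in_phase => _; split=> [zP p|/(_ p0 (mem_head _ _))].
    rewrite inE => /eqP->; move: zP.
    by rewrite /phase_constraint /entry_value /exit_value !big_nil addr0; repeat case: ifP.
  by rewrite /phase_constraint /entry_value /exit_value !big_nil addr0; repeat case: ifP.
move=> wp0; have /and4P[/eqP Ep le01 ok wp1] := wp0; subst p.
have {IH}IH := IH p1 (z + op_effect o) wp1.
have ge1 q : q \in p1 :: [seq e.2 | e <- t] -> (p1 <= q)%N.
  rewrite inE => /orP[/eqP->//|/mapP[e et ->]].
  by have /andP[] := well_phased_ge wp1 et.
have entry0 : entry_value p0 ((p0, o, p1) :: t) = 0 by apply: entry_value0 wp0 _.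
have entryS q : (p0 < q)%N ->
    entry_value q ((p0, o, p1) :: t) = op_effect o + entry_value q t.
  by move=> lt_q; rewrite /entry_value big_cons /= lt_q.
have exitS q : (p1 <= q)%N ->
    exit_value q ((p0, o, p1) :: t) = op_effect o + exit_value q t.
  by move=> le_q; rewrite /exit_value big_cons /= le_q.
have exit0 q : (q < p1)%N -> exit_value q ((p0, o, p1) :: t) = 0.
  move=> lt_q; rewrite /exit_value big_cons /= leqNgt lt_q /=.
  exact: exit_value0 wp1 lt_q.
have later q : (p1 <= q)%N -> (p0 < q)%N ->
    phase_constraint z ((p0, o, p1) :: t) q = phase_constraint (z + op_effect o) t q.
  by move=> le1 lt0; rewrite /phase_constraint entryS // exitS // !addrA.
split.
  case/andP=> zP tP q; move/IH: (tP) => cP.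
  have [->|ne_q] := eqVneq q p0; last first.
    rewrite inE (negbTE ne_q) /= => q_in; have le1 := ge1 q q_in.
    by rewrite later ?cP // ltn_neqAle eq_sym ne_q (leq_trans le01).
  move=> _; move: zP; rewrite /phase_constraint /in_phase entry0 addr0.
  case: ifP => // z0 z1; case: ifP => // r0.
  move: le01; rewrite leq_eqVlt => /orP[/eqP E01|lt01]; last first.
    by rewrite exit0 // addr0.
  subst p1; have := cP p0 (mem_head _ _).
  by rewrite /phase_constraint z0 r0 exitS // addrA.
move=> cP; have tP : values_in_phase p1 (z + op_effect o) t.
  apply/IH => q q_in; have le1 := ge1 q q_in.
  have cq : phase_constraint z ((p0, o, p1) :: t) q by apply: cP; rewrite inE q_in orbT.
  have := leq_trans le01 le1; rewrite leq_eqVlt => /orP[/eqP E0q|lt0q]; last first.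
    by rewrite -later.
  (* The first step stays in [p0]: a zero or rising phase passes its constraint on by monotonicity,
     a falling one through its unchanged exit value. *)
  have E01 : p1 = p0 by apply/eqP; rewrite eqn_leq le01 E0q le1.
  subst p1 q; move: cq ok; rewrite /phase_constraint entry0 eqxx /=.
  rewrite (entry_value0 wp1) // exitS //.
  rewrite /op_allowed; case: zero_phase; case: rising_phase; case: (o) => //=; lia.
apply/andP; split=> //.
have := cP p0 (mem_head _ _); rewrite /phase_constraint /in_phase entry0 addr0.
case: ifP => // z0; case: ifP => // r0.
move: le01; rewrite leq_eqVlt => /orP[/eqP E01|lt01]; last by rewrite exit0 // addr0.
(* In a falling phase the next value is at least 1 and the step does not raise the counter. *)
subst p1; have : in_phase p0 (z + op_effect o) by case: (t) tP => [|[[? ?] ?] ?] /andP[].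
move: ok; rewrite eqxx /= /in_phase z0 /op_allowed z0 r0.
by case: (o) => //=; lia.
Qed.

(** * Blocks between reversals *)

(* Block m consists of the configurations between the m-th and the (m+1)-st
   reversal; the counter rises in even blocks and falls in odd ones. *)
Definition next_block (m : nat) (o : counter_op) : nat :=
  match o with Incr => m + odd m | Decr => m + ~~ odd m | Stay => m end.

(** The low bit is chosen so that the status met first in a block, zero when rising and positive
    when falling, gets the smaller number. *)
Definition phase (m c : nat) : nat := ((0 < c) (+) odd m + m.*2)%N.

Lemma half_phase m c : (phase m c)./2 = m.
Proof. exact: half_bit_double. Qed.

Lemma odd_phase m c : odd (phase m c) = (0 < c)%N (+) odd m.
Proof. by rewrite /phase oddD odd_double addbF oddb. Qed.

Lemma zero_phaseE m c : zero_phase (phase m c) = (c == 0%N).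
Proof. by rewrite /zero_phase half_phase odd_phase; case: c (odd m) => [|?] []. Qed.

Lemma in_phase_phase m (c : nat) : in_phase (phase m c) c%:Z.
Proof. by rewrite /in_phase zero_phaseE; case: c. Qed.

(** Equal phases force equal blocks, hence the right direction; a step to or from zero changes the
    phase. *)
Lemma phase_step m o c c1 : counter_step o c c1 ->
  (phase m c <= phase (next_block m o) c1)%N /\
  (phase m c == phase (next_block m o) c1 -> op_allowed (phase m c) o).
Proof.
move=> st; split.
  case: o st => /= st; rewrite /phase; case E: (odd m);
    rewrite /= ?addn0 ?addn1 /= ?E; case: (ltnP 0 c) => ?; case: (ltnP 0 c1) => ? /=; lia.
move=> /eqP E; have Em : m = next_block m o.
  by rewrite -[LHS](half_phase m c) E half_phase.
move: st Em; rewrite /op_allowed zero_phaseE /rising_phase half_phase.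
case: o E => //= E st; case Om: (odd m) => /=; rewrite ?andbT ?andbF; try lia.
  by move=> _; move: E; rewrite st /= Om addn0 /phase Om; case: c {st} => //=; lia.
Qed.

Lemma next_block_ge m s : (m <= foldl next_block m s)%N.
Proof. by elim: s m => //= o s IH m; apply: leq_trans (IH _); case: o => /=; lia. Qed.

(** The extra 1 pays for an initial decrement, which opens a block without being a reversal. *)
Lemma blocks_le_reversals s : (foldl next_block 0 s <= (reversals s).+1)%N.
Proof.
(* [~~ odd m] is the direction of block [m], so the marked operations are those that open a new
   block. *)
have blocksE m : foldl next_block m s =
    (m + count id (pairmap addb (~~ odd m) (pmap op_direction s)))%N.
  elim: s m => [|o s IH] m /=; first by rewrite addn0.
  rewrite IH; case: o => //=; case E: (odd m); rewrite /= ?addn1 ?addn0 /= ?E //=; lia.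
rewrite blocksE /reversals; case: (pmap op_direction s) => //= d ds.
by case: d => /=; lia.
Qed.

(** * The automaton on annotated transitions *)

Section Simulation.
Variables (A : finType) (M : counter_machine A) (r : nat).

Local Notation ctr := 'I_(cm_counters M).
(* At most r reversals give at most r + 2 blocks, as a counter whose first
   operation is a decrement would skip block 0. *)
Local Notation ph := 'I_(r.+1).*2.+2.

Definition node := (cm_state M * {ffun ctr -> ph})%type.

(** Source, input letter with operations, target. The zero tests are not stored, as the source
    phases determine them. *)
Definition letter := (node * (option A * {ffun ctr -> counter_op}) * node)%type.

Definition counter_trace (i : ctr) (w : seq letter) : seq (nat * counter_op * nat) :=
  [seq (val (e.1.1.2 i), e.1.2.2 i, val (e.2.2 i)) | e : letter <- w].

Definition spell (e : letter) : seq A := oapp (fun a => [:: a]) [::] e.1.2.1.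

Definition spelling (w : seq letter) : seq A := flatten (map spell w).

Lemma spelling_morphism : word_morphism spelling.
Proof. by split=> // u v; rewrite /spelling map_cat flatten_cat. Qed.

Lemma parikh_spelling (w : seq letter) :
  lincomb (fun e => parikh (spell e)) (parikh w) = parikh (spelling w).
Proof.
rewrite lincomb_parikh; elim: w => [|e w IH].
  by rewrite big_nil; apply/ffunP => a; rewrite !ffunE.
by rewrite big_cons IH; apply/ffunP => a; rewrite !ffunE /spelling /= count_cat.
Qed.

Section Automaton.
(* The phases which each counter is allowed to visit. *)
Variable U : {ffun ctr -> {set ph}}.

Definition valid_letter (e : letter) : bool :=
  cm_trans e.1.1.1 e.1.2.1 [ffun i => zero_phase (e.1.1.2 i)] e.2.1 e.1.2.2 &&
  [forall i, [&& (e.1.1.2 i <= e.2.2 i)%N,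
    (e.1.1.2 i == e.2.2 i :> nat) ==> op_allowed (e.1.1.2 i) (e.1.2.2 i) &
    e.2.2 i \in U i]].

Definition letter_step (s : option node) (e : letter) : option node :=
  if s is Some n then if (e.1.1 == n) && valid_letter e then Some e.2 else None
  else None.

(** Letters check only their target phases against [U], so the initial phase is checked here. *)
Definition accepting : {set option node} :=
  [set s | if s is Some n then (n.1 \in cm_final M) && [forall i, ord0 \in U i]
           else false].

Lemma foldl_letter_step_None w : foldl letter_step None w = None.
Proof. by elim: w. Qed.

Lemma accepted_traces n w : foldl letter_step (Some n) w \in accepting ->
  forall i, [/\ well_phased (n.2 i) (counter_trace i w), ord0 \in U i &
    forall e, e \in w -> e.2.2 i \in U i].
Proof.
elim: w n => [|e w IH] n /=.
  by rewrite inE => /andP[_ /forallP U0] i; split.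
case: ifP => [/andP[/eqP <- /andP[_ /forallP eP]] /IH{}IH i|]; last first.
  by rewrite foldl_letter_step_None inE.
have /and3P[le_e ok_e eU] := eP i; have [wpi U0 wU] := IH i.
split=> //; first by rewrite eqxx le_e ok_e wpi.
by move=> e'; rewrite inE => /orP[/eqP->|/wU].
Qed.

Lemma accepted_run n w (c : cm_values M) :
    foldl letter_step (Some n) w \in accepting ->
    (forall i, values_in_phase (n.2 i) (c i)%:Z (counter_trace i w)) ->
  exists s q c', q \in cm_final M /\ cm_run n.1 (spelling w) c s q c'.
Proof.
elim: w n c => [|e w IH] n c /=.
  rewrite inE => /andP[nF _] _; exists [::], n.1, c; split=> //; exact: cm_run_nil.
case: ifP => [/andP[/eqP <- /andP[tr_e _]] acc cP|]; last first.
  by rewrite foldl_letter_step_None inE.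
(* [absz] loses nothing: the new value lies in its phase, hence is non-negative. *)
pose c1 : cm_values M := [ffun i => absz ((c i)%:Z + op_effect (e.1.2.2 i))].
have c1E i : (c1 i)%:Z = (c i)%:Z + op_effect (e.1.2.2 i).
  have /andP[_] := cP i; rewrite ffunE => tP; apply: gez0_abs.
  have : in_phase (e.2.2 i) ((c i)%:Z + op_effect (e.1.2.2 i)).
    by case: (counter_trace i w) tP => [|[[? ?] ?] ?] /andP[].
  by rewrite /in_phase; case: ifP => _; lia.
have [|s [q [c' [qF run]]]] := IH e.2 c1 acc.
  by move=> i; rewrite c1E; have /andP[] := cP i.
exists (e.1.2.2 :: s), q, c'; split=> //.
have -> : spelling (e :: w) = oapp (fun a => a :: spelling w) (spelling w) e.1.2.1.
  by rewrite /spelling /= /spell; case: e.1.2.1.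
apply: cm_run_cons run; last first.
  by move=> i; have := c1E i; rewrite /counter_step; case: (e.1.2.2 i) => /=; lia.
have -> // : [ffun i => c i == 0%N] = [ffun i => zero_phase (e.1.1.2 i)].
apply/ffunP => i; rewrite !ffunE; have /andP[] := cP i.
by rewrite /in_phase; case: ifP => // _; case: (c i).
Qed.

(** The boolean splits the equation of a zero phase into two opposite inequalities; a positive phase
    repeats its inequality, and a phase outside [U] yields [0 <= 0]. *)
Definition constraint_weight (j : ctr * ph * bool) (e : letter) : int :=
  let: (i, p, b) := j in
  let entry := if (e.1.1.2 i < p)%N then op_effect (e.1.2.2 i) else 0 in
  let exit := if (e.2.2 i <= p)%N then op_effect (e.1.2.2 i) else 0 in
  if p \notin U i then 0
  else if zero_phase p then (if b then entry else - entry)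
  else if rising_phase p then entry else exit.

Definition constraint_bound (j : ctr * ph * bool) : int :=
  let: (i, p, _) := j in if (p \notin U i) || zero_phase p then 0 else 1.

Lemma constraintsP (w : seq letter) :
  (forall j, constraint_bound j <= lincomb (constraint_weight j) (parikh w)) <->
  (forall i (p : ph), p \in U i -> phase_constraint 0 (counter_trace i w) p).
Proof.
have entryE i (p : ph) : entry_value p (counter_trace i w) =
    \sum_(e <- w) if (e.1.1.2 i < p)%N then op_effect (e.1.2.2 i) else 0.
  by rewrite /entry_value big_map big_mkcond.
have exitE i (p : ph) : exit_value p (counter_trace i w) =
    \sum_(e <- w) if (e.2.2 i <= p)%N then op_effect (e.1.2.2 i) else 0.
  by rewrite /exit_value big_map big_mkcond.
split=> [cP i p pU|cP [[i p] b]].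
  have := cP (i, p, false); have := cP (i, p, true).
  rewrite /phase_constraint !add0r entryE exitE !lincomb_parikh.
  rewrite /constraint_bound /constraint_weight pU /=.
  case: (zero_phase p); last by case: (rising_phase p).
  by rewrite sumrN oppr_ge0 => ge0 le0; rewrite eq_le le0 ge0.
rewrite lincomb_parikh /constraint_bound /constraint_weight.
have [pU|pU] := boolP (p \in U i); last by rewrite /= big1.
have := cP i p pU; rewrite /phase_constraint !add0r entryE exitE /=.
case: (zero_phase p); last by case: (rising_phase p).
by case: b => [/eqP->//|/eqP E]; rewrite sumrN E.
Qed.

(** All visited phases lie in [U], so the constraints indexed by [U] cover those that keep the
    counters in phase. *)
Lemma accepted_sound q0 w :
    foldl letter_step (Some (q0, [ffun=> ord0])) w \in accepting ->
    (forall j, constraint_bound j <= lincomb (constraint_weight j) (parikh w)) ->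
  exists s q c', q \in cm_final M /\ cm_run q0 (spelling w) [ffun=> 0%N] s q c'.
Proof.
move=> acc /constraintsP cP; apply: (accepted_run acc) => i; rewrite !ffunE.
have [wp U0 wU] := accepted_traces acc i; rewrite ffunE in wp.
apply/(values_in_phaseP _ wp) => p; rewrite inE => /orP[/eqP->|]; first exact: cP.
by rewrite -map_comp => /mapP[e /wU eU ->]; apply: cP.
Qed.

End Automaton.

Definition phases (m : ctr -> nat) (c : cm_values M) : {ffun ctr -> ph} :=
  [ffun i => inord (phase (m i) (c i))].

Lemma phasesE (m : ctr -> nat) c i : (m i <= r.+1)%N ->
  phases m c i = phase (m i) (c i) :> nat.
Proof. by move=> le_m; rewrite ffunE inordK // /phase; case: addb => /=; lia. Qed.

(** Annotates a run with the phases of its configurations. [U] is quantified after [w] because it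
    can only be chosen once the visited phases are known; the block bound keeps [inord] away from
    its default value. *)
Lemma run_accepted q x c s q' c' (m : ctr -> nat) :
    cm_run q x c s q' c' -> q' \in cm_final M ->
    (forall i, (foldl next_block (m i) [seq o i | o : cm_ops M <- s] <= r.+1)%N) ->
  exists w, [/\ spelling w = x,
    forall U : {ffun ctr -> {set ph}},
      (forall i, ord0 \in U i /\ forall e, e \in w -> e.2.2 i \in U i) ->
      foldl (letter_step U) (Some (q, phases m c)) w \in accepting U &
    forall i, values_in_phase (phases m c i) (c i)%:Z (counter_trace i w)].
Proof.
move=> run; elim: run m => {q x c s q' c'} [q c|q q1 q2 x w c c1 c2 o s tr st run IH] m qF le_m.
  exists [::]; split=> // [U UP|i] /=.
    by rewrite inE qF; apply/forallP => i; have [] := UP i.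
  by rewrite andbT phasesE ?in_phase_phase //; apply: le_m.
have le_m0 i : (m i <= r.+1)%N by apply: leq_trans (le_m i); apply: next_block_ge.
pose m1 i := next_block (m i) (o i).
have le_m1 i : (m1 i <= r.+1)%N.
  by apply: leq_trans (le_m i) => /=; apply: next_block_ge.
have [v [Ev acc vP]] := IH m1 qF le_m.
exists ((q, phases m c, (x, o), (q1, phases m1 c1)) :: v); split.
- by rewrite /spelling /= -/(spelling v) Ev /spell /=; case: x {tr}.
- move=> U UP /=; rewrite eqxx /=.
  have -> : valid_letter U (q, phases m c, (x, o), (q1, phases m1 c1)).
    apply/andP; split=> /=.
      congr cm_trans: tr; apply/ffunP => i.
      by rewrite ffunE [RHS]ffunE phasesE // zero_phaseE.
    apply/forallP => i; have [_ /(_ _ (mem_head _ _)) /= ->] := UP i.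
    rewrite !phasesE //; have [-> ok] := phase_step (m i) (st i).
    by rewrite andbT; apply/implyP.
  apply: acc => i; have [U0 vU] := UP i; split=> // e ev.
  by apply: vU; rewrite inE ev orbT.
- move=> i /=; rewrite phasesE // in_phase_phase /=.
  have -> : (c i)%:Z + op_effect (o i) = (c1 i)%:Z.
    by have := st i; rewrite /counter_step; case: (o i) => /=; lia.
  exact: vP.
Qed.

Lemma accepting_complete x s : cm_accepting x s ->
    (forall i, (reversals [seq o i | o : cm_ops M <- s] <= r)%N) ->
  exists (U : {ffun ctr -> {set ph}}) (w : seq letter), [/\ spelling w = x,
    foldl (letter_step U) (Some (cm_start M, [ffun=> ord0])) w \in accepting U &
    forall j, constraint_bound U j <= lincomb (constraint_weight U j) (parikh w)].
Proof.
move=> [q [c [qF run]]] le_r.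
have [|w [Ew acc wP]] := run_accepted (m := fun=> 0%N) run qF.
  by move=> i; apply: leq_trans (blocks_le_reversals _) _; rewrite ltnS.
have Eph : phases (fun=> 0%N) [ffun=> 0%N] = [ffun=> ord0].
  by apply/ffunP => i; apply: val_inj; rewrite /= phasesE // !ffunE.
rewrite Eph in acc wP.
(* Exactly the visited phases: a constraint at an unvisited phase might fail. *)
pose U : {ffun ctr -> {set ph}} :=
  [ffun i => [set p : ph | val p \in 0%N :: [seq e.2 | e <- counter_trace i w]]%SET].
have accU : foldl (letter_step U) (Some (cm_start M, [ffun=> ord0])) w \in accepting U.
  apply: acc => i; rewrite ffunE inE; split=> // e ew.
  rewrite inE; apply/orP; right; rewrite -map_comp.
  by apply/mapP; exists e.
exists U, w; split=> //; apply/constraintsP => i p.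
have [wp _ _] := accepted_traces accU i; move: wp (wP i); rewrite !ffunE => wp.
by move=> /(values_in_phaseP _ wp) cP; rewrite inE => /cP.
Qed.

End Simulation.

(** * Transfer of semi-linearity through the full trio *)

Theorem theorem17 (C : language_family)
  (C_trio : full_trio C)
  (C_semilinear : forall (A : finType) (L : language A),
     C A L -> semilinear_language L)
  (A : finType) (L : language A) :
  wedge C NCM A L -> semilinear_language L.
Proof.
move=> [L1 CL1 [_ [M [[r rP] ->]] <-]].
pose start : option (node M r) := Some (cm_start M, [ffun=> ord0]).
pose K U : language (letter M r) := (@spelling A M r @^-1` L1) `&`
  [set w | foldl (letter_step U) start w \in accepting U].
have CK U : C _ (K U).
  apply: full_trio_regular => //.
    by apply: full_trio_inverse_morphism CL1 => //; apply: spelling_morphism.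
  by exists _, start, (accepting U), (letter_step U).
(* [U] ranges over a finite type, so the union over all guesses of visited phases is finite.
   Weighting each letter by the Parikh vector of its spelling projects to the input alphabet. *)
have := semilinear_bigcup (fun U => semilinear_constrained_image
  (fun e : letter M r => parikh (spell e)) (constraint_weight U)
  (constraint_bound U) (C_semilinear _ _ (CK U))).
congr semilinear_set; rewrite eqEsubset; split=> v.
  move=> [U _ [_ [[w [wL1 acc] <-] wP] <-]].
  rewrite parikh_spelling; exists (spelling w) => //; split=> //.
  have [s [q [c [qF run]]]] := accepted_sound acc wP.
  by exists s, q, c.
move=> [x [xL1 [s acc]] <-].
have [U [w [Ew accw wP]]] := accepting_complete acc (rP x s acc).
exists U => //; exists (parikh w); last by rewrite parikh_spelling Ew.
by split=> //; exists w => //; split=> //=; rewrite Ew.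
Qed.
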